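(* Let $G$ be a graph, let $u,v$ be distinct vertices of $G$, let $m>1$ be an integer and let $a,b\in\{1,\ldots,m\}$. Let $t$ be a positive integer. Then there is peak state transfer from $u$ to $v$ at time $t$ in the arc-reversal walk on $G$ if and only if there is peak state transfer from $(u,a)$ to $(v,b)$ at time $t$ in the arc-reversal walk on $G[\overline{K_m}]$.
   Context: Graphs are finite, simple and without isolated vertices. For a graph $G$ and an integer $m>1$, the blow-up $G[\overline{K_m}]$ (lexicographic product of $G$ with the empty graph on $m$ vertices) has vertex set $V(G)\times\{1,\ldots,m\}$, with $(u,a)\sim(v,b)$ if and only if $u\sim v$ in $G$. Arc-reversal walk on a graph $G=(V,E)$: let $\mathcal{A}$ be the set of arcs (ordered pairs $(u,v)$ with $uv\in E$; $u$ is the tail). Let $N\in\mathbb{R}^{\mathcal{A}\times V}$ with $N(a,v)=1/\sqrt{d(v)}$ if $v$ is the tail of $a$ and $0$ otherwise ($d(v)$ is the degree), and let $R$ be the permutation matrix on $\mathcal{A}$ swapping $(u,v)$ and $(v,u)$. The transition matrix is $U=R(2NN^T-I)$. Put $B_t=N^TU^tN$ for integers $t\ge0$, and $B=B_1=D^{-1/2}AD^{-1/2}$, where $A$ is the adjacency matrix and $D$ the diagonal degree matrix. Let $B=\sum_\theta\theta E_\theta$ be the spectral decomposition ($\theta$ over distinct eigenvalues, $E_\theta$ the orthogonal projection onto the $\theta$-eigenspace). For distinct vertices $x,y$ there is peak state transfer from $x$ to $y$ at time $t$ (a positive integer) if $|B_t(x,y)|=\sum_\theta|E_\theta(x,y)|$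 and $E_\theta(x,y)\neq0$ for at least one $\theta$. *)

(* Defs.v *)
From HB Require Import structures.
From mathcomp Require Import all_boot all_order all_algebra.
From mathcomp Require Import polyrcf.

Set Implicit Arguments.
Unset Strict Implicit.
Unset Printing Implicit Defensive.

Import Order.TTheory GRing.Theory Num.Theory.
Local Open Scope ring_scope.

Record sgraph (V : finType) := SGraph {
  adj : rel V;
  adj_sym : symmetric adj;
  adj_irr : irreflexive adj;
  adj_no_isolated : forall x, exists y, adj x y }.

Section Blowup.
Variables (V : finType) (G : sgraph V) (m : nat).

Definition blowup_adj : rel (V * 'I_m) := fun p q => adj G p.1 q.1.

Lemma blowup_sym : symmetric blowup_adj.
Proof. by move=> p q; exact: adj_sym. Qed.

Lemma blowup_irr : irreflexive blowup_adj.
Proof. by move=> p; exact: adj_irr. Qed.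

Lemma blowup_no_isolated p : exists q, blowup_adj p q.
Proof. by have [y py] := adj_no_isolated G p.1; exists (y, p.2). Qed.

Definition blowup : sgraph (V * 'I_m)%type :=
  SGraph blowup_sym blowup_irr blowup_no_isolated.

End Blowup.

Section Projections.
Variables (R : rcfType) (n : nat).
Implicit Types (U M : 'M[R]_n) (theta : R).

(* Subspaces are row spaces, as in mxalgebra: the rows of [kermx U^T] span the
   orthogonal complement of the row space of [U], and matrices act on row
   vectors from the right. *)
Definition orthoproj U : 'M[R]_n := proj_mx U (kermx U^T).

Definition eigenvalues M : seq R := rootsR (char_poly M).

(* [eigenspace M theta] consists of the left eigenvectors, which are the
   (transposed) right eigenvectors when [M] is symmetric. *)
Definition eigenproj M theta : 'M[R]_n := orthoproj (eigenspace M theta).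

End Projections.

Section Walk.
Variables (R : rcfType) (V : finType) (G : sgraph V).

Definition arc : finType := {a : V * V | adj G a.1 a.2}.
Definition tail (a : arc) : V := (val a).1.
Definition head (a : arc) : V := (val a).2.

Definition deg (v : V) : nat := #|[set w | adj G v w]|.

(* Matrices indexed by a finite type T are indexed by 'I_#|T| through
   enum_val / enum_rank. *)
Definition tail_mx : 'M[R]_(#|arc|, #|V|) :=
  \matrix_(i, j) (if tail (enum_val i) == enum_val j
                  then (Num.sqrt (deg (enum_val j))%:R)^-1 else 0).

Definition rev_mx : 'M[R]_#|arc| :=
  \matrix_(i, j) ((tail (enum_val i) == head (enum_val j)) &&
                  (head (enum_val i) == tail (enum_val j)))%:R.

Definition transition_mx : 'M[R]_#|arc| :=
  rev_mx *m (2 *: (tail_mx *m tail_mx^T) - 1%:M).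

Definition walk_mx (t : nat) : 'M[R]_#|V| :=
  tail_mx^T *m transition_mx ^+ t *m tail_mx.

Definition adj_mx : 'M[R]_#|V| :=
  \matrix_(i, j) (adj G (enum_val i) (enum_val j))%:R.

Definition deg_rsqrt_mx : 'M[R]_#|V| :=
  diag_mx (\row_i (Num.sqrt (deg (enum_val i))%:R)^-1).

Definition norm_adj_mx : 'M[R]_#|V| :=
  deg_rsqrt_mx *m adj_mx *m deg_rsqrt_mx.

Definition walk_entry (t : nat) (x y : V) : R :=
  walk_mx t (enum_rank x) (enum_rank y).

Definition eigenproj_entry (theta : R) (x y : V) : R :=
  eigenproj norm_adj_mx theta (enum_rank x) (enum_rank y).

Definition peak_state_transfer (x y : V) (t : nat) : Prop :=
  [/\ x != y, (0 < t)%N,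
      `|walk_entry t x y| =
        \sum_(theta <- eigenvalues norm_adj_mx) `|eigenproj_entry theta x y|
    & exists2 theta, theta \in eigenvalues norm_adj_mx &
        eigenproj_entry theta x y != 0].

End Walk.

Section Facts.
Variable R : rcfType.

Lemma mem_eigenvalues n (M : 'M[R]_n) theta :
  (theta \in eigenvalues M) = eigenvalue M theta.
Proof.
rewrite eigenvalue_root_char.
have p0 : char_poly M != 0 by apply: monic_neq0; exact: char_poly_monic.
by rewrite -(roots_on_rootsR p0) in_itv.
Qed.

Lemma eigenvalues_uniq n (M : 'M[R]_n) : uniq (eigenvalues M).
Proof. exact: uniq_roots. Qed.

Lemma mul_row_tr_eq0 n (w : 'rV[R]_n) : w *m w^T = 0 -> w = 0.
Proof.
move=> /matrixP /(_ 0 0); rewrite !mxE => /eqP.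
rewrite psumr_eq0 => [/allP w0|i _]; last by rewrite mxE -expr2 sqr_ge0.
apply/rowP=> j; rewrite mxE; apply/eqP.
by have := w0 j (mem_index_enum _); rewrite mxE mulf_eq0 orbb.
Qed.

Lemma cap_ortho n (U : 'M[R]_n) : (U :&: kermx U^T = 0)%MS.
Proof.
apply/eqP/rowV0P=> w; rewrite sub_capmx => /andP[/submxP[c wE] /sub_kermxP wU].
by apply: mul_row_tr_eq0; rewrite {2}wE trmx_mul mulmxA wU mul0mx.
Qed.

Lemma add_ortho n (U : 'M[R]_n) : row_full (U + kermx U^T)%MS.
Proof.
rewrite /row_full; have := mxrank_sum_cap U (kermx U^T).
rewrite cap_ortho mxrank0 addn0 => ->.
by rewrite mxrank_ker mxrank_tr subnKC // rank_leq_row.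
Qed.

Lemma orthoproj_range n (U : 'M[R]_n) : (orthoproj U :=: U)%MS.
Proof.
apply/eqmxP/andP; split.
  by rewrite -[orthoproj U]mul1mx proj_mx_sub.
by rewrite -{1}(proj_mx_id (cap_ortho U) (submx_refl U)) submxMl.
Qed.

Lemma orthoproj_idem n (U : 'M[R]_n) :
  orthoproj U *m orthoproj U = orthoproj U.
Proof. exact: proj_mx_proj (cap_ortho U). Qed.

Lemma orthoproj_sym n (U : 'M[R]_n) : (orthoproj U)^T = orthoproj U.
Proof.
set P := orthoproj U.
have PK : (1%:M - P) *m P^T = 0.
  have /sub_kermxP KU : (1%:M - P <= kermx U^T)%MS.
    have := @proj_mx_compl_sub _ _ n U (kermx U^T) 1%:M.
    rewrite mul1mx; apply.
    by rewrite submx_full ?add_ortho.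
  have /submxP[c PE] : (P <= U)%MS by rewrite orthoproj_range.
  by rewrite [in P^T]PE trmx_mul mulmxA KU mul0mx.
move/eqP: PK; rewrite mulmxBl mul1mx subr_eq0 => /eqP PT.
move: P PT => P PT; have := congr1 trmx PT; rewrite trmx_mul !trmxK -PT => PE.
by rewrite -PE.
Qed.

Variables (V : finType) (G : sgraph V).

Lemma deg_gt0 v : (0 < deg G v)%N.
Proof.
by have [w vw] := adj_no_isolated G v; apply/card_gt0P; exists w; rewrite inE.
Qed.

Lemma rev_tail_mxE (i : 'I_#|arc G|) (j : 'I_#|V|) :
  (rev_mx R G *m tail_mx R G) i j =
  if head (enum_val i) == enum_val j
  then (Num.sqrt (deg G (enum_val j))%:R)^-1 else 0.
Proof.
rewrite mxE.
have ra : adj G (head (enum_val i)) (tail (enum_val i)).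
  by rewrite adj_sym; exact: (valP (enum_val i)).
pose r : arc G := exist _ (head (enum_val i), tail (enum_val i)) ra.
rewrite (bigD1 (enum_rank r)) //= big1 => [|k /negP kr].
  by rewrite addr0 !mxE enum_rankK /tail /head /= !eqxx mul1r.
rewrite !mxE; case: andP => [[/eqP h1 /eqP h2]|]; last by rewrite mul0r.
case: kr; apply/eqP; apply: enum_val_inj; rewrite enum_rankK.
apply: val_inj; rewrite /= h1 h2.
exact: surjective_pairing.
Qed.

Lemma sum_arc (F : V -> V -> R) :
  \sum_(i < #|arc G|) F (tail (enum_val i)) (head (enum_val i)) =
  \sum_x \sum_(y | adj G x y) F x y.
Proof.
rewrite pair_big_dep /= (reindex_omap (val : arc G -> _) insub) => [|p Pp].
  rewrite (reindex (@enum_val (arc G) (arc G))) /=; last first.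
    by apply: onW_bij; exact: enum_val_bij.
  by apply: eq_bigl => i; rewrite valK eqxx andbT (valP (enum_val i)).
by rewrite insubT.
Qed.

Lemma tail_mx_tr_mul : (tail_mx R G)^T *m tail_mx R G = 1%:M.
Proof.
apply/matrixP=> i j; rewrite !mxE.
pose F x (y : V) : R := (if x == enum_val i
    then (Num.sqrt (deg G (enum_val i))%:R)^-1 else 0) *
  (if x == enum_val j then (Num.sqrt (deg G (enum_val j))%:R)^-1 else 0).
transitivity (\sum_(k < #|arc G|) F (tail (enum_val k)) (head (enum_val k))).
  by apply: eq_bigr => k _; rewrite !mxE.
rewrite sum_arc (bigD1 (enum_val i)) //= [X in _ + X]big1 ?addr0; last first.
  by move=> x /negPf xi; rewrite big1 // => y _; rewrite /F xi mul0r.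
rewrite sumr_const /F eqxx (inj_eq enum_val_inj).
case: (eqVneq i j) => [->|_]; last by rewrite mulr0 mul0rn.
have d0 : (deg G (enum_val j))%:R != 0 :> R by rewrite pnatr_eq0 -lt0n deg_gt0.
have -> : #|[pred y | adj G (enum_val j) y]| = deg G (enum_val j).
  by rewrite /deg cardsE.
by rewrite -invfM -expr2 sqr_sqrtr ?ler0n // -[LHS]mulr_natr mulVf.
Qed.

Lemma tail_rev_tail_mx :
  (tail_mx R G)^T *m rev_mx R G *m tail_mx R G = norm_adj_mx R G.
Proof.
apply/matrixP=> i j; rewrite -mulmxA mxE.
pose F x y : R := (if x == enum_val i
    then (Num.sqrt (deg G (enum_val i))%:R)^-1 else 0) *
  (if y == enum_val j then (Num.sqrt (deg G (enum_val j))%:R)^-1 else 0).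
transitivity (\sum_(k < #|arc G|) F (tail (enum_val k)) (head (enum_val k))).
  by apply: eq_bigr => k _; rewrite rev_tail_mxE !mxE.
rewrite sum_arc (bigD1 (enum_val i)) //= [X in _ + X]big1 ?addr0; last first.
  by move=> x /negPf xi; rewrite big1 // => y _; rewrite /F xi mul0r.
rewrite /norm_adj_mx /deg_rsqrt_mx mul_mx_diag mul_diag_mx !mxE.
rewrite big_mkcond /= (bigD1 (enum_val j)) //= big1 ?addr0 => [|y /negPf yj].
  by rewrite /F !eqxx; case: (adj G _ _); rewrite ?mulr1 // mulr0 mul0r.
by rewrite /F yj mulr0; case: (adj G _ _).
Qed.

Lemma walk_mx1 : walk_mx R G 1 = norm_adj_mx R G.
Proof.
rewrite /walk_mx expr1 /transition_mx -tail_rev_tail_mx mulmxBr mulmx1.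
rewrite mulmxBr mulmxBl -scalemxAr -scalemxAr -scalemxAl !mulmxA.
by rewrite -[_ *m _^T *m _]mulmxA tail_mx_tr_mul mulmx1 scaler_nat mulr2n addrK.
Qed.

End Facts.

(* Main.v *)
Require Import Defs.
From mathcomp Require Import all_boot all_order all_algebra.
From mathcomp Require Import ring.

(** Write [B], [B'] for the normalized adjacency matrices of [G] and of its
    blow-up, and let [S] be the matrix with entry [1 / sqrt m] at
    [((x, c), x)] and [0] elsewhere.  Its columns are orthonormal
    ([blowup_isometry_iso]) and [B' = S B S^T] ([norm_adj_blowup]).  Hence [B']
    acts as [B] on the column space of [S] and vanishes on its orthogonal
    complement, which gives:
    - since [B_(t+2) = 2 B B_(t+1) - B_t] ([walk_mxSS]), the matrix [B'_t] is
      [S B_t S^T] plus a multiple of [1 - S S^T] ([walk_mx_blowup]);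
    - for every [theta], eigenvalue or not, [E'_theta] is [S E_theta S^T], plus
      [1 - S S^T] if [theta = 0] ([eigenproj_isometry]).

    The entry of [1 - S S^T] at [((u, a), (v, b))] is zero as [u != v], and the
    entry of [S M S^T] there is [M(u, v) / m].  So both sides of the equation
    defining peak state transfer are divided by [m] when passing from [G] to
    the blow-up, and the same spectral projections have a nonzero entry.  The
    spectra may differ by the eigenvalue [0]; this does not matter, because the
    projections attached to non-eigenvalues are zero
    ([sum_eigenproj_supset]). *)

Set Implicit Arguments.
Unset Strict Implicit.
Unset Printing Implicit Defensive.

Import Order.TTheory GRing.Theory Num.Theory.
Local Open Scope ring_scope.

(** * Orthogonal projections onto eigenspaces *)

Section EigenProjections.
Variable R : rcfType.

(** A symmetric [P] with range in [U] which fixes the rows of [U] is the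
    orthogonal projection onto [U]. *)
Lemma orthoproj_unique n (U P : 'M[R]_n) :
  P^T = P -> (P <= U)%MS -> U *m P = U -> orthoproj U = P.
Proof.
move=> PT PU UP; set Q := orthoproj U.
have QP : Q *m P = Q.
  have /submxP[c ->] : (Q <= U)%MS by rewrite orthoproj_range.
  by rewrite -mulmxA UP.
have PQ : P *m Q = P by rewrite /Q /orthoproj proj_mx_id ?cap_ortho.
by rewrite -[LHS]orthoproj_sym -/Q -QP trmx_mul PT orthoproj_sym.
Qed.

Lemma eigenproj_sym n (M : 'M[R]_n) theta :
  (eigenproj M theta)^T = eigenproj M theta.
Proof. exact: orthoproj_sym. Qed.

Lemma eigenproj_mul n (M : 'M[R]_n) theta :
  eigenproj M theta *m M = theta *: eigenproj M theta.
Proof. by apply/eigenspaceP; rewrite orthoproj_range. Qed.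

Lemma eigenproj_id k n (M : 'M[R]_n) theta (W : 'M[R]_(k, n)) :
  W *m M = theta *: W -> W *m eigenproj M theta = W.
Proof. by move/eigenspaceP=> WM; rewrite proj_mx_id ?cap_ortho. Qed.

Lemma eigenproj_eq0 n (M : 'M[R]_n) theta :
  theta \notin eigenvalues M -> eigenproj M theta = 0.
Proof.
rewrite mem_eigenvalues negbK => /eqP M0.
by apply/eqP; rewrite -mxrank_eq0 orthoproj_range M0 mxrank0.
Qed.

Lemma sum_eigenproj_supset n (M : 'M[R]_n) (s : seq R) i j :
  uniq s -> {subset eigenvalues M <= s} ->
  \sum_(theta <- s) `|eigenproj M theta i j| =
  \sum_(theta <- eigenvalues M) `|eigenproj M theta i j|.
Proof.
move=> s_uniq sub; rewrite (bigID (mem (eigenvalues M))) /=.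
rewrite [X in _ + X]big1 ?addr0 => [|theta /eigenproj_eq0 ->]; last first.
  by rewrite mxE normr0.
rewrite -big_filter; apply: perm_big; apply: uniq_perm.
- exact: filter_uniq.
- exact: eigenvalues_uniq.
by move=> theta; rewrite mem_filter andb_idr //; exact: sub.
Qed.

(** Extending [M] by zero on the orthogonal complement of the column space of
    [S] leaves the eigenspaces unchanged up to the isometry [S], except that
    the kernel gains that complement. *)
Lemma eigenproj_isometry k n (S : 'M[R]_(k, n)) (M : 'M[R]_n) theta :
  S^T *m S = 1%:M ->
  eigenproj (S *m M *m S^T) theta =
  S *m eigenproj M theta *m S^T + (theta == 0)%:R *: (1%:M - S *m S^T).
Proof.
move=> SS.
have Eid (W : 'M[R]_(k, n)) : W *m M = theta *: W -> W *m eigenproj M theta = W.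
  exact: eigenproj_id.
(* [eigenproj M theta] is convertible to a product of matrices, which the
   rewriting rules for products would break up; it is made abstract. *)
move: (eigenproj_sym M theta) (eigenproj_mul M theta) Eid.
move: (eigenproj M theta) => E ET EM Eid.
apply: orthoproj_unique.
- rewrite linearD linearZ linearB /= trmx1 !trmx_mul trmxK ET.
  by rewrite mulmxA.
- apply/eigenspaceP; rewrite mulmxDl -scalemxAl mulmxBl mul1mx (scalerDr theta).
  congr (_ + _).
    rewrite !mulmxA -[S *m E *m _ *m S]mulmxA SS mulmx1 -(mulmxA S E M).
    by rewrite EM -scalemxAr -scalemxAl.
  rewrite !mulmxA -[S *m _ *m S]mulmxA SS mulmx1 subrr scaler0 scalerA.
  by case: eqP => [->|_]; rewrite ?mulr0 ?mul0r scale0r.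
have /eigenspaceP := submx_refl (eigenspace (S *m M *m S^T) theta).
move: (eigenspace _ _) => K; rewrite !mulmxA => KB.
(* The rows of [K S] are eigenvectors of [M], so [E] fixes them; the rest of
   [K], its part orthogonal to the range of [S], vanishes unless [theta = 0]. *)
have KSM : K *m S *m M = theta *: (K *m S).
  have /(congr1 (mulmx^~ S)) := KB.
  by rewrite /= -(mulmxA _ S^T) SS mulmx1 -scalemxAl.
rewrite mulmxDr !mulmxA (Eid _ KSM) -scalemxAr mulmxBr mulmx1 mulmxA.
case: eqVneq => [_|theta0]; first by rewrite scale1r addrC subrK.
rewrite scale0r addr0; apply: (scalerI theta0).
by rewrite scalemxAl -KSM KB.
Qed.

End EigenProjections.

(** * The three-term recurrence of the walk *)

Section Recurrence.
Variables (R : rcfType) (V : finType) (G : sgraph V).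
Local Notation N := (tail_mx R G).
Local Notation Rev := (rev_mx R G).
Local Notation U := (transition_mx R G).

Lemma rev_mx_involutive : Rev *m Rev = 1%:M.
Proof.
apply/matrixP=> i j; rewrite mxE.
have ra : adj G (Defs.head (enum_val i)) (Defs.tail (enum_val i)).
  by rewrite adj_sym; exact: (valP (enum_val i)).
(* The only nonzero term of the sum is at the reversal [r] of the arc [i]. *)
pose r : Defs.arc G := exist _ (Defs.head (enum_val i), Defs.tail (enum_val i)) ra.
rewrite (bigD1 (enum_rank r)) //= big1 => [|k /negP kr].
  rewrite addr0 !mxE enum_rankK /Defs.tail /Defs.head /= !eqxx mul1r.
  rewrite andbC -[RHS]/((i == j)%:R); congr (_%:R).
  by rewrite -(inj_eq enum_val_inj) -val_eqE.
rewrite !mxE; case: andP => [[/eqP h1 /eqP h2]|]; last by rewrite mul0r.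
case: kr; apply/eqP; apply: enum_val_inj; rewrite enum_rankK.
by apply: val_inj; rewrite /= h1 h2; exact: surjective_pairing.
Qed.

Lemma walk_mx0 : walk_mx R G 0 = 1%:M.
Proof. by rewrite /walk_mx expr0 mulmx1 tail_mx_tr_mul. Qed.

(** The Chebyshev recurrence; it holds because [N^T R U = N^T]. *)
Lemma walk_mxSS t :
  walk_mx R G t.+2 = 2 *: (norm_adj_mx R G *m walk_mx R G t.+1) - walk_mx R G t.
Proof.
have NRU : N^T *m Rev *m U = N^T.
  rewrite /transition_mx !mulmxA -[N^T *m Rev *m Rev]mulmxA.
  rewrite rev_mx_involutive mulmx1 mulmxBr mulmx1 -scalemxAr mulmxA.
  by rewrite tail_mx_tr_mul mul1mx scaler_nat mulr2n addrK.
have NU : N^T *m U = 2 *: (norm_adj_mx R G *m N^T) - N^T *m Rev.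
  rewrite /transition_mx mulmxA mulmxBr mulmx1 -scalemxAr mulmxA.
  by rewrite tail_rev_tail_mx.
rewrite /walk_mx exprS -[U * _]/(U *m _) mulmxA NU mulmxBl mulmxBl.
rewrite -scalemxAl -scalemxAl !mulmxA; congr (_ - _).
by rewrite exprS -[U * _]/(U *m _) mulmxA NRU.
Qed.

End Recurrence.

(** * The blow-up isometry *)

Section BlowupIsometry.
Variables (R : rcfType) (V : finType) (G : sgraph V) (m : nat).
Hypothesis m_gt0 : (0 < m)%N.

(** The index of [x] as a function of the index of [(x, c)]. *)
Definition blowup_proj (i : 'I_#|{: V * 'I_m}|) : 'I_#|V| :=
  enum_rank (enum_val i).1.

(** The matrix [S]: it spreads the unit vector at [x] evenly over the copies
    [(x, c)] of [x]. *)
Definition blowup_isometry : 'M[R]_(#|{: V * 'I_m}|, #|V|) :=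
  (Num.sqrt m%:R)^-1 *: rowsub blowup_proj 1%:M.

Local Notation S := blowup_isometry.

(** Conjugating by [S] repeats each entry [M(x, y)] at all [((x, c), (y, d))],
    divided by [m]. *)
Lemma blowup_conjE (M : 'M[R]_#|V|) :
  S *m M *m S^T = m%:R^-1 *: mxsub blowup_proj blowup_proj M.
Proof.
apply/matrixP=> i j.
rewrite /blowup_isometry linearZ /= -!scalemxAl -scalemxAr scalerA.
rewrite -invfM -expr2 sqr_sqrtr ?ler0n // mul_rowsub_mx mul1mx !mxE.
congr (_ * _); rewrite (bigD1 (blowup_proj j)) //= big1 => [|k kj].
  by rewrite !mxE eqxx mulr1 addr0.
by rewrite !mxE eq_sym (negPf kj) mulr0.
Qed.

Lemma blowup_isometry_iso : S^T *m S = 1%:M.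
Proof.
apply/matrixP=> i j.
rewrite /blowup_isometry -scalemxAr linearZ /= -scalemxAl scalerA.
rewrite -invfM -expr2 sqr_sqrtr ?ler0n // !mxE.
(* Up to the factor [1 / m], the entry counts the vertices of the blow-up
   lying above both [i] and [j]. *)
pose F (x : V) : R := (enum_rank x == i)%:R * (enum_rank x == j)%:R.
transitivity (m%:R^-1 * \sum_(p : V * 'I_m) F p.1).
  congr (_ * _); rewrite [RHS](reindex _ (onW_bij _ (enum_val_bij _))) /=.
  by apply: eq_bigr => k _; rewrite !mxE.
rewrite -(pair_bigA _ (fun x (_ : 'I_m) => F x)) /=.
rewrite (bigD1 (enum_val i)) //= [X in _ + X]big1 ?addr0 => [|x xi]; last first.
  rewrite big1 // => _ _; rewrite /F -{1}(enum_valK i) (inj_eq enum_rank_inj).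
  by rewrite (negPf xi) mul0r.
rewrite sumr_const card_ord /F enum_valK eqxx mul1r -[X in _ * X]mulr_natr.
by rewrite mulrCA mulVf ?mulr1 // pnatr_eq0 -lt0n.
Qed.

Lemma deg_blowup (p : V * 'I_m) : deg (blowup G m) p = (deg G p.1 * m)%N.
Proof.
rewrite /deg -[X in (_ * X)%N](card_ord m) -cardsT -cardsX.
by apply: eq_card => q; rewrite !inE andbT.
Qed.

Lemma norm_adj_blowup :
  norm_adj_mx R (blowup G m) = S *m norm_adj_mx R G *m S^T.
Proof.
rewrite blowup_conjE; apply/matrixP=> i j.
rewrite /norm_adj_mx /deg_rsqrt_mx !mul_mx_diag !mul_diag_mx !mxE.
rewrite !deg_blowup !natrM !sqrtrM ?ler0n // !invfM !enum_rankK /=.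
have -> : m%:R^-1 = (Num.sqrt m%:R)^-1 * (Num.sqrt m%:R)^-1 :> R.
  by rewrite -invfM -expr2 sqr_sqrtr ?ler0n.
by rewrite /blowup_adj; ring.
Qed.

(** The scalar [c] is [T_t(0)] for the Chebyshev polynomial [T_t], as
    [B_t = T_t(B)]; its value does not matter. *)
Lemma walk_mx_blowup t : exists c : R,
  walk_mx R (blowup G m) t = S *m walk_mx R G t *m S^T + c *: (1%:M - S *m S^T).
Proof.
pose P t := exists c : R,
  walk_mx R (blowup G m) t = S *m walk_mx R G t *m S^T + c *: (1%:M - S *m S^T).
(* The recurrence needs two consecutive times. *)
suff [] : P t /\ P t.+1 by [].
elim: t => [|t [[c Pt] [d PSt]]]; split.
- by exists 1; rewrite !walk_mx0 mulmx1 scale1r addrC subrK.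
- by exists 0; rewrite !walk_mx1 norm_adj_blowup scale0r addr0.
- by exists d.
exists (- c); rewrite !walk_mxSS Pt PSt norm_adj_blowup.
move: (norm_adj_mx R G) (walk_mx R G t.+1) (walk_mx R G t) => B W1 W0.
move: S blowup_isometry_iso => T TT.
have TB (W : 'M[R]_(#|V|, #|{: V * 'I_m}|)) :
    T *m B *m T^T *m (T *m W) = T *m (B *m W).
  by rewrite mulmxA -(mulmxA _ T^T) TT mulmx1 mulmxA.
have Bcompl : T *m B *m T^T *m (1%:M - T *m T^T) = 0.
  by rewrite mulmxBr mulmx1 TB mulmxA subrr.
rewrite mulmxDr -scalemxAr Bcompl scaler0 addr0 -(mulmxA T W1) TB.
rewrite mulmxBr mulmxBl -scalemxAr -scalemxAl !mulmxA.
by rewrite opprD addrA scaleNr.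
Qed.

(** Above distinct vertices the entries of [1 - S S^T] vanish, since [S S^T] is
    block diagonal. *)
Lemma blowup_conj_entry (M : 'M[R]_#|V|) c x y (a b : 'I_m) : x != y ->
  (S *m M *m S^T + c *: (1%:M - S *m S^T))
    (enum_rank (x, a)) (enum_rank (y, b)) =
  m%:R^-1 * M (enum_rank x) (enum_rank y).
Proof.
move=> xy; have -> : S *m S^T = S *m 1%:M *m S^T by rewrite mulmx1.
rewrite !blowup_conjE !mxE /blowup_proj !enum_rankK /=.
rewrite !(inj_eq enum_rank_inj) (negPf xy) xpair_eqE (negPf xy) /=.
by rewrite mulr0 subrr mulr0 addr0.
Qed.

Lemma walk_entry_blowup t x y (a b : 'I_m) : x != y ->
  walk_entry R (blowup G m) t (x, a) (y, b) = m%:R^-1 * walk_entry R G t x y.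
Proof.
move=> xy; rewrite /walk_entry; have [c ->] := walk_mx_blowup t.
exact: blowup_conj_entry.
Qed.

Lemma eigenproj_entry_blowup (theta : R) x y (a b : 'I_m) : x != y ->
  eigenproj_entry (blowup G m) theta (x, a) (y, b) =
  m%:R^-1 * eigenproj_entry G theta x y.
Proof.
move=> xy; rewrite /eigenproj_entry norm_adj_blowup.
rewrite eigenproj_isometry ?blowup_isometry_iso //.
exact: blowup_conj_entry.
Qed.

Lemma sum_eigenproj_entry_blowup x y (a b : 'I_m) : x != y ->
  \sum_(theta <- eigenvalues (norm_adj_mx R (blowup G m)))
     `|eigenproj_entry (blowup G m) theta (x, a) (y, b)| =
  m%:R^-1 * \sum_(theta <- eigenvalues (norm_adj_mx R G))
     `|eigenproj_entry G theta x y|.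
Proof.
move=> xy; set B := norm_adj_mx R G; set B' := norm_adj_mx R (blowup G m).
(* Both sums can be taken over the union of the two spectra. *)
pose s := undup (eigenvalues B ++ eigenvalues B').
have s_uniq : uniq s := undup_uniq _.
rewrite -(@sum_eigenproj_supset _ _ B' s) // => [|theta]; last first.
  by rewrite mem_undup mem_cat => ->; rewrite orbT.
rewrite -(@sum_eigenproj_supset _ _ B s) // => [|theta]; last first.
  by rewrite mem_undup mem_cat => ->.
rewrite mulr_sumr; apply: eq_bigr => theta _.
rewrite -[eigenproj B' _ _ _]/(eigenproj_entry _ _ _ _).
by rewrite eigenproj_entry_blowup // normrM ger0_norm ?invr_ge0 ?ler0n.
Qed.

End BlowupIsometry.

(** * Peak state transfer in the blow-up *)

Lemma eigenproj_entry_neq0 (R : rcfType) (V : finType) (G : sgraph V)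
    (theta : R) x y :
  eigenproj_entry G theta x y != 0 -> theta \in eigenvalues (norm_adj_mx R G).
Proof.
by apply: contraR => /eigenproj_eq0 E0; rewrite /eigenproj_entry E0 mxE.
Qed.

Theorem lemma4p3 (R : rcfType) (V : finType) (G : sgraph V) (u v : V)
    (m : nat) (a b : 'I_m) (t : nat) :
  u != v -> (1 < m)%N -> (0 < t)%N ->
  peak_state_transfer R G u v t <->
  peak_state_transfer R (blowup G m) (u, a) (v, b) t.
Proof.
move=> uv m_gt1 t_gt0; have m_gt0 := ltnW m_gt1.
have m0 : m%:R^-1 != 0 :> R by rewrite invr_eq0 pnatr_eq0 -lt0n.
rewrite /peak_state_transfer walk_entry_blowup // sum_eigenproj_entry_blowup //.
rewrite normrM ger0_norm ?invr_ge0 ?ler0n // xpair_eqE (negPf uv) /=.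
have entry_neq0 theta :
    (eigenproj_entry (blowup G m) theta (u, a) (v, b) != 0) =
    (eigenproj_entry G theta u v != 0 :> R).
  by rewrite eigenproj_entry_blowup // mulf_eq0 (negPf m0).
split=> -[_ _ sumE [theta _ E0]]; split=> //.
- by rewrite sumE.
- rewrite -entry_neq0 in E0; exists theta; last exact: E0.
  exact: eigenproj_entry_neq0 E0.
- exact: (mulfI m0).
- rewrite entry_neq0 in E0; exists theta; last exact: E0.
  exact: eigenproj_entry_neq0 E0.
Qed.
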